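(* Let $\mathcal{S}\subseteq M_d$ be an operator system. The following are equivalent: (i) $\theta(\mathcal{S})=1$; (ii) $\hat\theta(\mathcal{S})=1$; (iii) $\mathcal{S}=M_d$.
   Context: An operator system in $M_d$ (complex $d\times d$ matrices, with the operator norm) is a linear subspace $\mathcal{S}$ containing $I$ and closed under adjoints. A quantum channel is a completely positive trace preserving linear map. If $\Phi:M_d\to M_k$ is completely positive with Kraus representation $\Phi(T)=\sum_{p=1}^mA_pTA_p^*$, put $\mathcal{S}_\Phi=\mathrm{span}\{A_p^*A_q : p,q=1,\dots,m\}$ (independent of the Kraus representation), and let $\Phi^*:M_k\to M_d$ be the dual map, determined by $\mathrm{Tr}(T\Phi^*(S))=\mathrm{Tr}(\Phi(T)S)$. Let $\mathfrak{C}(\mathcal{S})$ be the set of all quantum channels $\Phi:M_d\to M_k$, $k\in\mathbb{N}$ arbitrary, with $\mathcal{S}_\Phi\subseteq\mathcal{S}$. Define $\mathrm{th}(\mathcal{S})=\{T\in M_d^+ : \Phi(T)\le I\text{ for every }\Phi\in\mathfrak{C}(\mathcal{S})\}$, $\theta(\mathcal{S})=\sup\{\mathrm{Tr}(T) : T\in\mathrm{th}(\mathcal{S})\}$, and $$\hat\theta(\mathcal{S})=\inf\{\|\Phi^*(\sigma)^{-1}\| : \Phi\in\mathfrak{C}(\mathcal{S}),\ \sigma\ge 0,\ \mathrm{Tr}(\sigma)\le 1,\ \Phi^*(\sigma)\text{ invertible}\}.$$ *)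

(* Defs.v *)
From HB Require Import structures.
From mathcomp Require Import all_boot all_order all_algebra.
From mathcomp Require Import sesquilinear spectral.
From mathcomp Require Import complex.
From mathcomp Require Import all_classical all_reals ereal.

Set Implicit Arguments.
Unset Strict Implicit.
Unset Printing Implicit Defensive.

Import Order.TTheory GRing.Theory Num.Theory.
Local Open Scope classical_set_scope.
Local Open Scope ring_scope.
Local Open Scope sesquilinear_scope.
Local Open Scope complex_scope.

Section OperatorSystems.
Variable R : realType.
Local Notation C := R[i].

Definition l2norm (n : nat) (v : 'cV[C]_n) : R :=
  Num.sqrt (\sum_i Normc.normc (v i 0) ^+ 2).

Definition opnorm (m n : nat) (A : 'M[C]_(m, n)) : R :=
  sup [set l2norm (A *m v) | v in [set v : 'cV[C]_n | l2norm v <= 1]].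

(* [0 <= z] in [R[i]] means that [z] is real and nonnegative, so this forces
   [A] to be Hermitian. *)
Definition psdmx (n : nat) (A : 'M[C]_n) : Prop :=
  forall v : 'cV[C]_n, 0 <= (v ^t* *m A *m v) 0 0.

Definition le_mx (n : nat) (A B : 'M[C]_n) : Prop := psdmx (B - A).

Definition operator_system (d : nat) (S : {vspace 'M[C]_d}) : Prop :=
  1%:M \in S /\ forall X : 'M[C]_d, X \in S -> X ^t* \in S.

(* The block matrix on the right is the image of the one on the left under
   [id (x) Phi : M_n(M_d) -> M_n(M_k)]. *)
Definition completely_positive (d k : nat)
    (Phi : {linear 'M[C]_d -> 'M[C]_k}) : Prop :=
  forall (n : nat) (B : 'I_n -> 'I_n -> 'M[C]_d),
    psdmx (\mxblock_(i < n, j < n) B i j) ->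
    psdmx (\mxblock_(i < n, j < n) Phi (B i j)).

Definition trace_preserving (d k : nat)
    (Phi : {linear 'M[C]_d -> 'M[C]_k}) : Prop :=
  forall T : 'M[C]_d, \tr (Phi T) = \tr T.

Definition quantum_channel (d k : nat)
    (Phi : {linear 'M[C]_d -> 'M[C]_k}) : Prop :=
  completely_positive Phi /\ trace_preserving Phi.

Definition kraus_rep (d k m : nat) (Phi : {linear 'M[C]_d -> 'M[C]_k})
    (A : 'I_m -> 'M[C]_(k, d)) : Prop :=
  forall T : 'M[C]_d, Phi T = \sum_(p < m) A p *m T *m (A p) ^t*.

Definition kraus_span (d k m : nat) (A : 'I_m -> 'M[C]_(k, d)) :
    {vspace 'M[C]_d} :=
  <<[seq (A p) ^t* *m A q | p <- enum 'I_m, q <- enum 'I_m]>>%VS.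

(* The space S_Phi, for [Phi] completely positive: the span does not depend on
   the Kraus representation of [Phi], so the union over all the
   representations is the span given by any one of them. *)
Definition channel_space (d k : nat) (Phi : {linear 'M[C]_d -> 'M[C]_k}) :
    set 'M[C]_d :=
  [set X | exists (m : nat) (A : 'I_m -> 'M[C]_(k, d)),
     kraus_rep Phi A /\ X \in kraus_span A].

(* The members of C(S) with values in M_k. *)
Definition channels (d : nat) (S : {vspace 'M[C]_d}) (k : nat) :
    set {linear 'M[C]_d -> 'M[C]_k} :=
  [set Phi | quantum_channel Phi /\ channel_space Phi `<=` [set X | X \in S]].

(* The trace dual; [dual_mapP] and [dual_map_unique] show that it is the map
   determined by the trace pairing. *)
Definition dual_map (d k : nat) (Phi : {linear 'M[C]_d -> 'M[C]_k})
    (Y : 'M[C]_k) : 'M[C]_d :=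
  \matrix_(i < d, j < d) \tr (Phi (delta_mx j i) *m Y).

Lemma dual_mapP (d k : nat) (Phi : {linear 'M[C]_d -> 'M[C]_k})
    (T : 'M[C]_d) (Y : 'M[C]_k) :
  \tr (T *m dual_map Phi Y) = \tr (Phi T *m Y).
Proof.
rewrite [in RHS](matrix_sum_delta T) linear_sum /= mulmx_suml raddf_sum /=.
apply: eq_bigr => i _.
rewrite mxE linear_sum /= mulmx_suml raddf_sum /=.
by apply: eq_bigr => j _; rewrite mxE linearZ /= -scalemxAl mxtraceZ.
Qed.

Lemma dual_map_unique (d k : nat) (Phi : {linear 'M[C]_d -> 'M[C]_k})
    (Y : 'M[C]_k) (Z : 'M[C]_d) :
  (forall T : 'M[C]_d, \tr (T *m Z) = \tr (Phi T *m Y)) ->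
  Z = dual_map Phi Y.
Proof.
move=> H; apply/matrixP => i j; rewrite mxE -H.
rewrite /mxtrace (bigD1 j) //= mxE (bigD1 i) //= mxE !eqxx mul1r.
rewrite big1 => [|l li]; last by rewrite mxE eqxx (negPf li) mul0r.
rewrite addr0 big1 ?addr0 // => l lj; rewrite mxE big1 // => p _.
by rewrite mxE (negPf lj) mul0r.
Qed.

Definition th (d : nat) (S : {vspace 'M[C]_d}) : set 'M[C]_d :=
  [set T | psdmx T /\
     forall (k : nat) (Phi : {linear 'M[C]_d -> 'M[C]_k}),
       channels S Phi -> le_mx (Phi T) 1%:M].

Definition theta (d : nat) (S : {vspace 'M[C]_d}) : \bar R :=
  ereal_sup [set (complex.Re (\tr T))%:E | T in th S].

Definition theta_hat (d : nat) (S : {vspace 'M[C]_d}) : \bar R :=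
  ereal_inf [set r : \bar R |
    exists (k : nat) (Phi : {linear 'M[C]_d -> 'M[C]_k}) (sigma : 'M[C]_k),
      [/\ channels S Phi, psdmx sigma, \tr sigma <= 1,
          dual_map Phi sigma \in unitmx &
          r = (opnorm (invmx (dual_map Phi sigma)))%:E]].

End OperatorSystems.

(* Main.v *)
Require Import Defs.
From HB Require Import structures.
From mathcomp Require Import all_boot all_order all_algebra.
From mathcomp Require Import sesquilinear spectral.
From mathcomp Require Import complex.
From mathcomp Require Import all_classical all_reals ereal.
From mathcomp Require Import ring.

Set Implicit Arguments.
Unset Strict Implicit.
Unset Printing Implicit Defensive.

Import Order.TTheory GRing.Theory Num.Theory.
Local Open Scope classical_set_scope.
Local Open Scope ring_scope.
Local Open Scope sesquilinear_scope.

(** The equivalences are read off from three facts about a nonzero [d] and a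
    subspace [S] of the [d x d] matrices.

    - One always has [1 <= theta S <= theta_hat S] ([theta_ge1],
      [theta_le_theta_hat]). A rank one projection has trace [1], so its image
      under a channel is positive of trace [1], hence at most [I]. The second
      inequality is weak duality: with [K := Phi^*(sigma)] and
      [r := opnorm (K^-1)] one has [I <= r K], so that
      [Tr T <= r Tr (T K) = r Tr (Phi(T) sigma) <= r].

    - If [S] is the full matrix space then [theta_hat S <= 1]
      ([theta_hat_full_le1]): the trace, as a channel to the 1 x 1 matrices, is
      allowed, and its dual maps [1] to the identity.

    - If [S] is proper then [1 < theta S] ([theta_gt1]). A channel that sends
      the identity close to the bound [d] in some direction [psi] would be
      nearly the constant channel [T |-> Tr T psi psi^*], whose space is
      everything; this cannot happen when its space lies in a proper [S]. So
      there is [c > 0], the same for all the channels of [S], with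
      [Phi(I) <= (d - c) I] ([channel_gap]), and [(d - c)^-1 I] is a point
      of [th S] with trace greater than [1].

    For the uniform bound, take Kraus operators [A_p] of [Phi] and a unit
    vector [psi], let [Q := I - psi psi^*], and consider the defect
    [D := \sum_p (Q A_p)^* (Q A_p)]. From [\sum_p A_p^* A_p = I] it follows
    that [D_ij = delta_ij - \sum_p a_p,i (a_p,j)^*] where
    [a_p := A_p^* psi], and that
    [Tr D = d - psi^* Phi(I) psi]. The combinations
    [X_i := \sum_p a_p,i A_p] satisfy [psi^* X_i = e_i^* (I - D)], while
    [Q X_i] has squared Hilbert-Schmidt norm at most [Tr D] by
    Cauchy-Schwarz. Therefore [X_i^* X_j], an element of [S], differs
    from the matrix unit [E_ij] by at most [3 Tr D + (Tr D)^2] in each entry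
    ([steer_gram_near]). A linear functional that vanishes on [S] but not on
    [E_ij] bounds [Tr D] below, by a constant that does not involve the channel
    ([functional_le_defect]).

    Kraus operators come from Choi's argument ([completely_positive_kraus]),
    applied to a factorization [G^* G] of the Choi matrix. *)

(** * Adjoints and the Cauchy-Schwarz inequality *)

Section Adjoint.
Variable C : numClosedFieldType.

Lemma adjmxM (m n p : nat) (A : 'M[C]_(m, n)) (B : 'M[C]_(n, p)) :
  (A *m B) ^t* = B ^t* *m A ^t*.
Proof. by rewrite trmx_mul map_mxM. Qed.

Lemma adjmxB (m n : nat) (A B : 'M[C]_(m, n)) : (A - B) ^t* = A ^t* - B ^t*.
Proof. by apply/matrixP => i j; rewrite !mxE rmorphB. Qed.

Lemma adjmxZ (m n : nat) (a : C) (A : 'M[C]_(m, n)) :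
  (a *: A) ^t* = a^* *: A ^t*.
Proof. by apply/matrixP => i j; rewrite !mxE rmorphM. Qed.

Lemma adjmx_sum (m n : nat) (I : finType) (F : I -> 'M[C]_(m, n)) :
  (\sum_i F i) ^t* = \sum_i (F i) ^t*.
Proof.
apply/matrixP => i j; rewrite !mxE !summxE rmorph_sum.
by apply: eq_bigr => p _; rewrite !mxE.
Qed.

Lemma adjmx1 (n : nat) : (1%:M : 'M[C]_n) ^t* = 1%:M.
Proof. by apply/matrixP => i j; rewrite !mxE rmorph_nat eq_sym. Qed.

Lemma gram_entry (m n p : nat) (A : 'M[C]_(m, n)) (B : 'M[C]_(m, p)) i j :
  (A ^t* *m B) i j = \sum_r (A r i)^* * B r j.
Proof. by rewrite mxE; apply: eq_bigr => r _; rewrite !mxE. Qed.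

Lemma sqnormE (n : nat) (v : 'cV[C]_n) :
  (v ^t* *m v) 0 0 = \sum_i `|v i 0| ^+ 2.
Proof. by rewrite gram_entry; apply: eq_bigr => i _; rewrite normCKC. Qed.

Lemma sqnorm_ge0 (n : nat) (v : 'cV[C]_n) : 0 <= (v ^t* *m v) 0 0.
Proof. by rewrite sqnormE sumr_ge0 // => i _; rewrite exprn_ge0. Qed.

Lemma sqnorm_eq0 (n : nat) (v : 'cV[C]_n) : (v ^t* *m v) 0 0 = 0 -> v = 0.
Proof.
move=> /eqP; rewrite sqnormE psumr_eq0 => [/allP v0|i _]; last exact: exprn_ge0.
apply/colP => i; rewrite mxE; apply/eqP; rewrite -normr_eq0 -sqrf_eq0.
by apply: v0; rewrite mem_index_enum.
Qed.

Lemma sqnormZ (n : nat) (a : C) (v : 'cV[C]_n) :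
  ((a *: v) ^t* *m (a *: v)) 0 0 = `|a| ^+ 2 * (v ^t* *m v) 0 0.
Proof. by rewrite adjmxZ -scalemxAl -scalemxAr scalerA mxE normCKC. Qed.

Lemma CauchySchwarz_cV (n : nat) (u v : 'cV[C]_n) :
  `|(u ^t* *m v) 0 0| ^+ 2 <= (u ^t* *m u) 0 0 * (v ^t* *m v) 0 0.
Proof.
have : `|dotmx (u ^t*) (v ^t*)| ^+ 2
    <= dotmx (u ^t*) (u ^t*) * dotmx (v ^t*) (v ^t*) := (CauchySchwarz _ _ _).1.
by rewrite !dotmxE !trmxCK.
Qed.

Lemma CauchySchwarz_sum (m : nat) (a b : 'I_m -> C) :
  `|\sum_p a p * b p| ^+ 2 <= (\sum_p `|a p| ^+ 2) * (\sum_p `|b p| ^+ 2).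
Proof.
have := CauchySchwarz_cV (\col_p (a p)^*) (\col_p b p).
rewrite !sqnormE gram_entry => H.
have -> : \sum_p a p * b p
        = \sum_p ((\col_p (a p)^*) p (0 : 'I_1))^* * (\col_p b p) p (0 : 'I_1).
  by apply: eq_bigr => p _; rewrite !mxE conjCK.
apply: (le_trans H); rewrite le_eqVlt; apply/orP; left; apply/eqP.
by congr (_ * _); apply: eq_bigr => p _; rewrite !mxE ?norm_conjC.
Qed.

(** Polarization: testing on [e_i + z e_j] for [z = 0, 1, 'i] is enough. It
    makes a matrix whose quadratic form is real Hermitian. *)
Lemma form_eq0 (n : nat) (B : 'M[C]_n) :
  (forall v : 'cV[C]_n, (v ^t* *m B *m v) 0 0 = 0) -> B = 0.
Proof.
move=> B0.
have ent (i j : 'I_n) (z : C) :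
  B i i + z * B i j + z^* * B j i + z^* * z * B j j = 0.
  have := B0 (delta_mx i 0 + z *: delta_mx j 0).
  rewrite -mulmxA mulmxDr -scalemxAr -!colE.
  have -> : (delta_mx i (0 : 'I_1) + z *: delta_mx j 0) ^t* =
            delta_mx 0 i + z^* *: delta_mx (0 : 'I_1) j.
    by apply/matrixP => a b; rewrite !mxE rmorphD rmorphM !rmorph_nat
      (andbC (b == i)) (andbC (b == j)).
  rewrite mulmxDl -scalemxAl -!rowE !mxE => <-; ring.
have diag i : B i i = 0 by have := ent i i 0; rewrite rmorph0 !mul0r !addr0.
apply/matrixP => i j; rewrite mxE.
have := ent i j 1; have := ent i j 'i; rewrite !diag conjCi rmorph1 !mulr0 !add0r.
rewrite !addr0 !mul1r mulNr -mulrBr => /eqP.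
rewrite mulf_eq0 (negPf (neq0Ci C)) /= subr_eq0 => /eqP ->.
by rewrite -mulr2n => /eqP; rewrite mulrn_eq0 => /eqP.
Qed.

End Adjoint.

(** * Positive semidefinite matrices *)

Section Psd.
Variable R : realType.
Local Notation C := R[i].

Lemma psdmx_gram (m n : nat) (G : 'M[C]_(m, n)) : psdmx (G ^t* *m G).
Proof. by move=> v; rewrite mulmxA -adjmxM -mulmxA sqnorm_ge0. Qed.

Lemma psdmx_herm (n : nat) (A : 'M[C]_n) : psdmx A -> A ^t* = A.
Proof.
move=> Apsd; apply/eqP; rewrite -subr_eq0; apply/eqP/form_eq0 => v.
rewrite mulmxBr mulmxBl mxE [X in _ + X]mxE; apply/eqP; rewrite subr_eq0.
have /geC0_conj := Apsd v.
have -> : (v ^t* *m A ^t* *m v) 0 0 = ((v ^t* *m A *m v) 0 0)^*;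
  last by move=> ->.
have -> : v ^t* *m A ^t* *m v = (v ^t* *m A *m v) ^t*.
  by rewrite !adjmxM trmxCK mulmxA.
by rewrite !mxE.
Qed.

(** In the spectral decomposition [P^* diag(l) P] the eigenvalues are the
    values of the quadratic form at the columns of [P^*], hence nonnegative;
    take [G := diag(sqrt l) P]. *)
Lemma psdmx_gram_ex (n : nat) (A : 'M[C]_n) :
  psdmx A -> exists G : 'M[C]_n, A = G ^t* *m G.
Proof.
move=> Apsd; have Aherm := psdmx_herm Apsd.
have Anormal : A \is normalmx by apply/normalmxP; rewrite Aherm.
have /orthomx_spectralP := Anormal.
have PU : spectralmx A \is unitarymx := spectral_unitarymx A.
rewrite invmx_unitary //.
set P := spectralmx A in PU *; set D := spectral_diag A => AE.
have PP : P *m P ^t* = 1%:M by apply/unitarymxP.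
have D_ge0 i : 0 <= D 0 i.
  have := Apsd (P ^t* *m delta_mx i 0).
  rewrite adjmxM trmxCK [in X in X -> _]AE !mulmxA.
  rewrite -(mulmxA _ P) PP mulmx1 -(mulmxA _ P) PP mulmx1.
  rewrite -colE mxE gram_entry (bigD1 i) //= big1 => [|r ri].
    by rewrite addr0 !mxE !eqxx rmorph1 mul1r mulr1n.
  by rewrite !mxE (negPf ri) rmorph0 mul0r.
exists (diag_mx (\row_i sqrtC (D 0 i)) *m P).
rewrite adjmxM {1}AE mulmxA -!mulmxA; congr (_ *m _); rewrite mulmxA.
congr (_ *m _); apply/matrixP => i j; rewrite gram_entry (bigD1 i) //= big1.
  rewrite !mxE eqxx addr0 mulr1n; have [->|] := eqVneq i j; last first.
    by rewrite !mulr0n mulr0.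
  rewrite !mulr1n (conj_Creal (ger0_real _)) ?sqrtC_ge0 // -expr2 sqrtCK //.
by move=> r ri; rewrite !mxE (negPf ri) mulr0n rmorph0 mul0r.
Qed.

Lemma psdmx_sum (n : nat) (I : finType) (F : I -> 'M[C]_n) :
  (forall i, psdmx (F i)) -> psdmx (\sum_i F i).
Proof.
by move=> F0 v; rewrite mulmx_sumr mulmx_suml summxE sumr_ge0 // => i _; apply: F0.
Qed.

(** With [B = G^* G] the trace is that of [G A G^*], whose diagonal entries are
    values of the quadratic form of [A]. *)
Lemma psdmx_trM_ge0 (n : nat) (A B : 'M[C]_n) :
  psdmx A -> psdmx B -> 0 <= \tr (A *m B).
Proof.
move=> Apsd /psdmx_gram_ex[G ->]; rewrite mulmxA mxtrace_mulC mulmxA sumr_ge0 //.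
move=> i _; have := Apsd ((row i G) ^t*).
rewrite trmxCK -row_mul mxE [X in _ -> 0 <= X]mxE => /le_trans; apply.
by rewrite le_eqVlt; apply/orP; left; apply/eqP/eq_bigr => j _; rewrite !mxE.
Qed.

Lemma psdmx_tr_ge0 (n : nat) (A : 'M[C]_n) : psdmx A -> 0 <= \tr A.
Proof.
move=> Apsd; rewrite -[A]mulmx1; apply: psdmx_trM_ge0 => // v.
by rewrite mulmx1 sqnorm_ge0.
Qed.

(** Writing [A = G^* G], this is Cauchy-Schwarz on each row of [G]. *)
Lemma psdmx_le_tr (n : nat) (A : 'M[C]_n) : psdmx A -> le_mx A (\tr A)%:M.
Proof.
move=> Apsd v; rewrite mulmxBr mulmxBl mxE [X in _ + X]mxE subr_ge0.
rewrite mul_mx_scalar -scalemxAl [X in _ <= X]mxE.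
have /psdmx_gram_ex[G ->] := Apsd.
rewrite mulmxA -adjmxM -mulmxA mxtrace_mulC sqnormE mulr_suml.
apply: ler_sum => i _; rewrite mxE.
have := CauchySchwarz_sum (fun j => G i j) (fun j => v j 0).
move=> /le_trans; apply.
rewrite sqnormE; apply: ler_wpM2r; first by rewrite -sqnormE sqnorm_ge0.
by rewrite mxE; apply: ler_sum => j _; rewrite !mxE -normCK.
Qed.

End Psd.

(** * Kraus representations of completely positive maps *)

Section Kraus.
Variable R : realType.
Local Notation C := R[i].

Lemma adjmx_mxcol (n k m : nat) (V : 'I_n -> 'M[C]_(k, m)) :
  (\mxcol_(i < n) V i) ^t* = \mxrow_(i < n) (V i) ^t*.
Proof. by apply/matrixP => i j; rewrite !mxE. Qed.

Lemma block_form (n k m : nat) (B : 'I_n -> 'I_n -> 'M[C]_k)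
    (V : 'I_n -> 'M[C]_(k, m)) :
  (\mxcol_(i < n) V i) ^t* *m (\mxblock_(i < n, j < n) B i j)
    *m (\mxcol_(i < n) V i) = \sum_i \sum_j (V i) ^t* *m B i j *m V j.
Proof.
rewrite adjmx_mxcol mul_mxrow_mxblock mul_mxrow_mxcol exchange_big /=.
by apply: eq_bigr => j _; rewrite mulmx_suml.
Qed.

(** Each Kraus operator turns the block form at [v] into the block form of the
    original matrix at the vector with blocks [A_p^* v_i]. *)
Lemma kraus_completely_positive (d k m : nat)
    (Phi : {linear 'M[C]_d -> 'M[C]_k}) (A : 'I_m -> 'M[C]_(k, d)) :
  kraus_rep Phi A -> completely_positive Phi.
Proof.
move=> PhiA n B Bpsd v; rewrite -[v]submxcolK block_form.
have -> : \sum_i \sum_j (submxcol v i) ^t* *m Phi (B i j) *m submxcol v j =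
  \sum_p (\mxcol_(i < n) ((A p) ^t* *m submxcol v i)) ^t*
    *m (\mxblock_(i < n, j < n) B i j)
    *m (\mxcol_(i < n) ((A p) ^t* *m submxcol v i)).
  under [RHS]eq_bigr do rewrite block_form.
  rewrite [RHS]exchange_big; apply: eq_bigr => i _ /=.
  rewrite [RHS]exchange_big; apply: eq_bigr => j _ /=.
  rewrite PhiA mulmx_sumr mulmx_suml; apply: eq_bigr => p _.
  by rewrite adjmxM trmxCK !mulmxA.
by rewrite summxE sumr_ge0 // => p _; apply: Bpsd.
Qed.

(** Choi's theorem. The block matrix of the matrix units is [w^* w] for a row
    [w], so its image, the Choi matrix, is positive and factors as
    [G^* G]. Each row of [G] is a row of [d] blocks of length [k]; the conjugates
    of these blocks are the columns of one Kraus operator. *)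
Lemma completely_positive_kraus (d k : nat)
    (Phi : {linear 'M[C]_d -> 'M[C]_k}) :
  completely_positive Phi ->
  exists (m : nat) (A : 'I_m -> 'M[C]_(k, d)), kraus_rep Phi A.
Proof.
move=> Phicp.
have psdE : psdmx (\mxblock_(i < d, j < d) (delta_mx i j : 'M[C]_d)).
  pose w := \mxrow_(i < d) (delta_mx 0 i : 'M[C]_(1, d)).
  suff -> : \mxblock_(i < d, j < d) (delta_mx i j : 'M[C]_d) = w ^t* *m w.
    exact: psdmx_gram.
  have -> : w ^t* = \mxcol_(i < d) (delta_mx i 0 : 'M[C]_(d, 1)).
    by apply/matrixP => i j; rewrite !mxE rmorph_nat andbC.
  by rewrite mul_mxcol_mxrow; apply: eq_mxblock => i j; rewrite mul_delta_mx.
have /psdmx_gram_ex[G GE] := Phicp d _ psdE.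
have {GE} PhiE i j : Phi (delta_mx i j) = (submxrow G i) ^t* *m submxrow G j.
  move: GE; rewrite -[G]submxrowK => /(congr1 (fun M => submxblock M i j)).
  rewrite mxblockK => ->; rewrite submxrowK.
  by apply/matrixP => a b; rewrite !mxE; apply: eq_bigr => p _; rewrite !mxE.
pose A p : 'M[C]_(k, d) := \matrix_(a, i) (submxrow G i p a)^*.
have AE i j : Phi (delta_mx i j) = \sum_p A p *m delta_mx i j *m (A p) ^t*.
  rewrite PhiE; apply/matrixP => a b; rewrite gram_entry summxE.
  apply: eq_bigr => p _; rewrite -(mul_delta_mx (0 : 'I_1)) mulmxA -mulmxA.
  by rewrite -colE -rowE [RHS]mxE big_ord1 !mxE conjCK.
exists _, A => T.
have expand (f : {linear 'M[C]_d -> 'M[C]_k}) :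
  f T = \sum_i \sum_j T i j *: f (delta_mx i j).
  rewrite {1}[T]matrix_sum_delta linear_sum; apply: eq_bigr => i _.
  by rewrite linear_sum; apply: eq_bigr => j _; rewrite linearZ.
have expandA p : A p *m T *m (A p) ^t* =
    \sum_i \sum_j T i j *: (A p *m delta_mx i j *m (A p) ^t*).
  exact: (expand (mulmxr ((A p) ^t*) \o mulmx (A p))).
rewrite expand; under [RHS]eq_bigr do rewrite expandA.
rewrite [RHS]exchange_big; apply: eq_bigr => i _ /=.
rewrite [RHS]exchange_big; apply: eq_bigr => j _ /=.
by rewrite AE scaler_sumr.
Qed.

(** The entry [(i, j)] of a matrix [M] is the trace of [M E_ji], so trace
    preservation determines the sum. *)
Lemma kraus_gram1 (d k m : nat) (Phi : {linear 'M[C]_d -> 'M[C]_k})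
    (A : 'I_m -> 'M[C]_(k, d)) :
  kraus_rep Phi A -> trace_preserving Phi ->
  \sum_p (A p) ^t* *m A p = 1%:M.
Proof.
move=> PhiA Phitp; apply/matrixP => i j.
have trE (M : 'M[C]_d) : M i j = \tr (M *m delta_mx j i).
  rewrite /mxtrace (bigD1 i) //= big1 => [|l li]; last first.
    by rewrite -(mul_delta_mx (0 : 'I_1)) mulmxA mxE big_ord1 -colE !mxE
      (negPf li) mulr0.
  by rewrite addr0 -(mul_delta_mx (0 : 'I_1)) mulmxA mxE big_ord1 -colE !mxE
      !eqxx mulr1.
rewrite [RHS]trE mul1mx -Phitp PhiA trE mulmx_suml !raddf_sum.
by apply: eq_bigr => p _; rewrite /= [RHS]mxtrace_mulC mulmxA.
Qed.

Lemma channel_kraus (d k : nat) (S : {vspace 'M[C]_d})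
    (Phi : {linear 'M[C]_d -> 'M[C]_k}) :
  channels S Phi -> exists (m : nat) (A : 'I_m -> 'M[C]_(k, d)),
  [/\ kraus_rep Phi A, \sum_p (A p) ^t* *m A p = 1%:M &
      forall p q, (A p) ^t* *m A q \in S].
Proof.
move=> [[Phicp Phitp] PhiS].
have [m [A PhiA]] := completely_positive_kraus Phicp.
exists m, A; split=> // [|p q]; first exact: kraus_gram1 PhiA Phitp.
apply: PhiS; exists m, A; split=> //; apply: memv_span.
apply: (allpairs_f (fun p q => (A p) ^t* *m A q)); exact: mem_enum.
Qed.

End Kraus.

(** * The defect of a Kraus family in a direction *)

Section Gap.
Variable C : numClosedFieldType.

(** The functional is an entry of [X - projv S X], chosen so that it is
    nonzero on some matrix unit. *)
Lemma vspace_annihilator (m n : nat) (S : {vspace 'M[C]_(m, n)}) :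
  S != fullv -> exists h : 'I_m -> 'I_n -> C,
    (exists i j, h i j != 0) /\
    forall X, X \in S -> \sum_i \sum_j h i j * X i j = 0.
Proof.
move=> SnT.
pose f (X : 'M[C]_(m, n)) := X - projv S X.
have [[i [j fij]]|fE0] : (exists i j, f (delta_mx i j) != 0) \/
    (forall i j, f (delta_mx i j) = 0).
  have [/existsP[i /existsP[j fij]]|] :=
    boolP [exists i, exists j, f (delta_mx i j) != 0]; first by left; exists i, j.
  rewrite negb_exists => /forallP f0; right=> i j; apply/eqP.
  by have := f0 i; rewrite negb_exists => /forallP/(_ j); rewrite negbK.
- have [a [b fab]] : exists a b, f (delta_mx i j) a b != 0.
    by apply/matrix0Pn.
  exists (fun k l => f (delta_mx k l) a b); split; first by exists i, j.
  move=> X XS; transitivity (f X a b); last by rewrite /f projv_id // subrr mxE.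
  rewrite /f [in RHS](matrix_sum_delta X) linear_sum /=.
  rewrite -sumrB summxE; apply: eq_bigr => k _.
  rewrite linear_sum -sumrB summxE; apply: eq_bigr => l _.
  by rewrite linearZ /= -scalerBr [RHS]mxE mulrC.
- case/negP: SnT; apply/eqP/vspaceP => X; rewrite memvf.
  rewrite (matrix_sum_delta X); apply: memv_suml => i _; apply: memv_suml => j _.
  by apply: memvZ; move: (fE0 i j) => /eqP; rewrite subr_eq0 => /eqP ->;
    rewrite memv_proj.
Qed.

Lemma tr_gramE (k d : nat) (M : 'M[C]_(k, d)) :
  \tr (M ^t* *m M) = \sum_r \sum_j `|M r j| ^+ 2.
Proof.
rewrite /mxtrace exchange_big /=; apply: eq_bigr => j _.
by rewrite gram_entry; apply: eq_bigr => r _; rewrite normCKC.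
Qed.

(** The arithmetic-geometric mean inequality, term by term; it avoids square
    roots in the estimates below. *)
Lemma gram_entry_le (k d e : nat) (M : 'M[C]_(k, d)) (N : 'M[C]_(k, e)) i j :
  `|(M ^t* *m N) i j| *+ 2 <= \tr (M ^t* *m M) + \tr (N ^t* *m N).
Proof.
rewrite gram_entry !tr_gramE -big_split /=.
apply: (@le_trans _ _ (\sum_r (`|M r i| ^+ 2 + `|N r j| ^+ 2))).
  apply: (@le_trans _ _ ((\sum_r `|(M r i)^* * N r j|) *+ 2)).
    by rewrite lerMn2r ler_norm_sum orbT.
  rewrite -sumrMnl; apply: ler_sum => r _; rewrite normrM norm_conjC.
  rewrite -subr_ge0.
  have -> : `|M r i| ^+ 2 + `|N r j| ^+ 2 - `|M r i| * `|N r j| *+ 2 =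
    (`|M r i| - `|N r j|) ^+ 2 by ring.
  by rewrite real_exprn_even_ge0 // realB.
have term p (z : 'I_p -> C) x : `|z x| ^+ 2 <= \sum_l `|z l| ^+ 2.
  by rewrite (bigD1 x) //= lerDl sumr_ge0 // => l _; apply: exprn_ge0.
by apply: ler_sum => r _; rewrite lerD // (term _ (fun l => _ r l)).
Qed.

Variables (k d m : nat) (psi : 'cV[C]_k) (A : 'I_m -> 'M[C]_(k, d)).
Hypothesis psi1 : psi ^t* *m psi = 1%:M.
Hypothesis A1 : \sum_p (A p) ^t* *m A p = 1%:M.

Definition coproj : 'M[C]_k := 1%:M - psi *m psi ^t*.

(** The part of [\sum_p A_p^* A_p = 1] that is lost when the outputs are
    compressed to the line of [psi]. *)
Definition defect : 'M[C]_d := \sum_p (coproj *m A p) ^t* *m (coproj *m A p).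

(** As [psi] is a unit vector, [coproj] is a self-adjoint idempotent. *)
Lemma coproj_gram (p q : nat) (X : 'M[C]_(k, p)) (Y : 'M[C]_(k, q)) :
  (coproj *m X) ^t* *m (coproj *m Y) =
  X ^t* *m Y - (psi ^t* *m X) ^t* *m (psi ^t* *m Y).
Proof.
have QH : coproj ^t* = coproj by rewrite adjmxB adjmx1 adjmxM trmxCK.
have QQ : coproj *m coproj = coproj.
  rewrite {1}/coproj mulmxBl mul1mx /coproj mulmxBr mulmx1 mulmxA -(mulmxA psi) psi1.
  by rewrite mulmx1 subrr subr0.
rewrite !adjmxM trmxCK QH mulmxA -(mulmxA _ coproj coproj) QQ.
rewrite /coproj mulmxBr mulmx1 mulmxBl.
by rewrite !mulmxA.
Qed.

Definition coef (p : 'I_m) (i : 'I_d) : C := ((A p) ^t* *m psi) i 0.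

Lemma psi_row p l : (psi ^t* *m A p) 0 l = (coef p l)^*.
Proof.
have -> : psi ^t* *m A p = ((A p) ^t* *m psi) ^t* by rewrite adjmxM trmxCK.
by rewrite mxE mxE.
Qed.

Lemma defect_entry i j :
  defect i j = (i == j)%:R - \sum_p coef p i * (coef p j)^*.
Proof.
rewrite /defect; under eq_bigr do rewrite coproj_gram.
rewrite sumrB A1 !mxE summxE; congr (_ - _).
by apply: eq_bigr => p _; rewrite gram_entry big_ord1 !psi_row conjCK.
Qed.

Lemma defect_entry_le i j : `|defect i j| <= \tr defect.
Proof.
rewrite /defect summxE raddf_sum; apply: (le_trans (ler_norm_sum _ _ _)).
apply: ler_sum => p _; rewrite -(ler_pMn2r (isT : 0 < 2)%N).
by apply: (le_trans (gram_entry_le _ _ _ _)).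
Qed.

(** The combination of Kraus operators whose compression to [psi] is the
    [i]-th row of [1 - defect], so that for small defect it is close to
    [psi e_i^*]. *)
Definition steer (i : 'I_d) : 'M[C]_(k, d) := \sum_p coef p i *: A p.

Lemma steer_row i l : (psi ^t* *m steer i) 0 l = (i == l)%:R - defect i l.
Proof.
rewrite defect_entry opprB addrC subrK mulmx_sumr summxE; apply: eq_bigr => p _.
by rewrite -scalemxAr mxE psi_row.
Qed.

(** The coefficients [coef p i] have squared norm [1 - defect i i <= 1], so
    Cauchy-Schwarz over [p], entry by entry, suffices. *)
Lemma steer_coproj_le i :
  \tr ((coproj *m steer i) ^t* *m (coproj *m steer i)) <= \tr defect.
Proof.
have Di_ge0 : 0 <= defect i i.
  rewrite /defect summxE sumr_ge0 // => p _; rewrite gram_entry sumr_ge0 // => r _.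
  by rewrite mulrC mul_conjC_ge0.
have aE : \sum_p `|coef p i| ^+ 2 = 1 - defect i i.
  by rewrite defect_entry eqxx opprB addrC subrK; apply: eq_bigr => p _; rewrite normCK.
have trD : \tr defect = \sum_r \sum_j \sum_p `|(coproj *m A p) r j| ^+ 2.
  rewrite /defect raddf_sum; under eq_bigr do rewrite /= tr_gramE.
  by rewrite exchange_big; apply: eq_bigr => r _; rewrite exchange_big.
rewrite tr_gramE trD; apply: ler_sum => r _; apply: ler_sum => j _.
have -> : (coproj *m steer i) r j = \sum_p coef p i * (coproj *m A p) r j.
  rewrite mulmx_sumr summxE; apply: eq_bigr => p _.
  by rewrite -scalemxAr mxE.
apply: (le_trans (CauchySchwarz_sum _ _)); rewrite aE.
rewrite ler_piMl ?gerBl // sumr_ge0 // => p _; exact: exprn_ge0.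
Qed.

(** The part of the Gram matrix along [psi] is the product of the
    approximations of [delta_ix] and [delta_jl], off by at most [t + t + t^2] for
    [t := \tr defect]; the part off [psi] contributes another [t]. *)
Lemma steer_gram_near i j x l :
  `|((steer i) ^t* *m steer j) x l - ((i == x) && (j == l))%:R|
    <= \tr defect *+ 3 + \tr defect ^+ 2.
Proof.
have -> : (steer i) ^t* *m steer j =
    (coproj *m steer i) ^t* *m (coproj *m steer j) +
    (psi ^t* *m steer i) ^t* *m (psi ^t* *m steer j) by rewrite coproj_gram subrK.
rewrite mxE [Y in _ + Y - _]gram_entry big_ord1 !steer_row.
rewrite rmorphB rmorph_nat -mulnb natrM.
set w := (_ *m _) x l; set u := (i == x)%:R; set v := (j == l)%:R.
have -> : w + (u - (defect i x)^*) * (v - defect j l) - u * v =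
  w - u * defect j l - v * (defect i x)^* + (defect i x)^* * defect j l by ring.
have tD0 : 0 <= \tr defect := le_trans (normr_ge0 _) (defect_entry_le i j).
have u1 : `|u| <= 1 by rewrite /u; case: eqP; rewrite ?normr1 ?normr0.
have v1 : `|v| <= 1 by rewrite /v; case: eqP; rewrite ?normr1 ?normr0.
have w1 : `|w| <= \tr defect.
  rewrite -(ler_pMn2r (isT : 0 < 2)%N); apply: (le_trans (gram_entry_le _ _ _ _)).
  by rewrite mulr2n lerD // steer_coproj_le.
have H1 : `|u * defect j l| <= \tr defect.
  by rewrite normrM -[\tr defect]mul1r ler_pM // defect_entry_le.
have H2 : `|v * (defect i x)^*| <= \tr defect.
  by rewrite normrM norm_conjC -[\tr defect]mul1r ler_pM // defect_entry_le.
have H3 : `|(defect i x)^* * defect j l| <= \tr defect ^+ 2.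
  by rewrite normrM norm_conjC expr2 ler_pM // defect_entry_le.
rewrite (le_trans (ler_normD _ _)) // lerD // mulrSr.
rewrite (le_trans (ler_normB _ _)) // lerD // mulr2n.
by rewrite (le_trans (ler_normB _ _)) // lerD.
Qed.

(** The matrix [(steer i)^* (steer j)] lies in [S], where the functional
    vanishes, and it is close to the matrix unit [E_ij], where the functional takes
    the value [h i j]. *)
Lemma functional_le_defect (S : {vspace 'M[C]_d}) (h : 'I_d -> 'I_d -> C) i j :
  (forall p q, (A p) ^t* *m A q \in S) ->
  (forall Y, Y \in S -> \sum_x \sum_l h x l * Y x l = 0) ->
  `|h i j| <= (\sum_x \sum_l `|h x l|) * (\tr defect *+ 3 + \tr defect ^+ 2).
Proof.
move=> AS hS.
have XS : (steer i) ^t* *m steer j \in S.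
  rewrite adjmx_sum mulmx_suml; apply: memv_suml => p _.
  rewrite mulmx_sumr; apply: memv_suml => q _.
  by rewrite adjmxZ -scalemxAl -scalemxAr !memvZ.
have hE : h i j = \sum_x \sum_l h x l * ((i == x) && (j == l))%:R.
  rewrite (bigD1 i) //= (bigD1 j) //= !eqxx mulr1 !big1 ?addr0 //.
    by move=> x xi; rewrite big1 // => l _; rewrite eq_sym (negPf xi) mulr0.
  by move=> l lj; rewrite [j == l]eq_sym (negPf lj) mulr0.
have {}hE : - h i j = \sum_x \sum_l
    h x l * (((steer i) ^t* *m steer j) x l - ((i == x) && (j == l))%:R).
  transitivity (\sum_x \sum_l h x l * ((steer i) ^t* *m steer j) x l -
      \sum_x \sum_l h x l * ((i == x) && (j == l))%:R).
    by rewrite hS // sub0r -hE.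
  rewrite -sumrB; apply: eq_bigr => x _; rewrite -sumrB; apply: eq_bigr => l _.
  by rewrite mulrBr.
rewrite -normrN hE; apply: (le_trans (ler_norm_sum _ _ _)); rewrite mulr_suml.
apply: ler_sum => x _; apply: (le_trans (ler_norm_sum _ _ _)).
rewrite mulr_suml; apply: ler_sum => l _.
by rewrite normrM ler_wpM2l // steer_gram_near.
Qed.

Lemma tr_defect :
  \tr defect = d%:R - \sum_p (psi ^t* *m A p *m (A p) ^t* *m psi) 0 0.
Proof.
rewrite /mxtrace; under eq_bigr do rewrite defect_entry eqxx.
rewrite sumrB sumr_const card_ord; congr (_ - _).
rewrite exchange_big; apply: eq_bigr => p _ /=.
rewrite -mulmxA mxE; apply: eq_bigr => i _.
by rewrite psi_row mulrC.
Qed.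

End Gap.

(** * Bounds on theta *)

Section Theta.
Variable R : realType.
Local Notation C := R[i].

Lemma kraus_psd (d k m : nat) (Phi : {linear 'M[C]_d -> 'M[C]_k})
    (A : 'I_m -> 'M[C]_(k, d)) (T : 'M[C]_d) :
  kraus_rep Phi A -> psdmx T -> psdmx (Phi T).
Proof.
move=> PhiA /psdmx_gram_ex[G ->]; rewrite PhiA; apply: psdmx_sum => p.
have -> : A p *m (G ^t* *m G) *m (A p) ^t* =
    (G *m (A p) ^t*) ^t* *m (G *m (A p) ^t*) by rewrite adjmxM trmxCK !mulmxA.
exact: psdmx_gram.
Qed.

Lemma psdmx_unitvec (n : nat) (M : 'M[C]_n) :
  (forall psi : 'cV[C]_n, psi ^t* *m psi = 1%:M ->
     0 <= (psi ^t* *m M *m psi) 0 0) -> psdmx M.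
Proof.
move=> Mpos v; have [->|v0] := eqVneq v 0; first by rewrite mulmx0 mxE.
have nv0 : (v ^t* *m v) 0 0 != 0 by apply: contra_neq v0 => /sqnorm_eq0.
set s := sqrtC ((v ^t* *m v) 0 0).
have s0 : s != 0 by rewrite sqrtC_eq0.
have s_ge0 : 0 <= s by rewrite sqrtC_ge0 sqnorm_ge0.
have -> : v = s *: (s^-1 *: v) by rewrite scalerA divff // scale1r.
rewrite adjmxZ -scalemxAr -!scalemxAl scalerA mxE.
rewrite mulr_ge0 ?mul_conjC_ge0 //; apply: Mpos.
rewrite [LHS]mx11_scalar sqnormZ normfV (ger0_norm s_ge0) exprVn sqrtCK.
by rewrite mulVf.
Qed.

(** The defect [t] in any direction satisfies [`|h i j| <= s (3 t + t^2)]. If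
    [t] were less than [c := `|h i j| / (4 s) < 1], the right-hand side would be
    at most [4 s t < `|h i j|]. The constant depends on [S] alone. *)
Lemma channel_gap (d : nat) (S : {vspace 'M[C]_d}) :
  S != fullv -> exists c : C, [/\ 0 < c, c < 1 &
    forall (k : nat) (Phi : {linear 'M[C]_d -> 'M[C]_k}),
      channels S Phi -> le_mx (Phi 1%:M) (d%:R - c)%:M].
Proof.
move=> /vspace_annihilator[h [[i [j hij]] hS]].
pose s := \sum_x \sum_l `|h x l|.
have hs : `|h i j| <= s.
  rewrite /s (bigD1 i) //= (bigD1 j) //= -addrA lerDl addr_ge0 ?sumr_ge0 //.
  by move=> x _; rewrite sumr_ge0.
have s0 : 0 < s by apply: lt_le_trans hs; rewrite normr_gt0.
pose c := `|h i j| / (s *+ 4).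
have c0 : 0 < c by rewrite divr_gt0 ?normr_gt0 ?mulrn_wgt0.
have c1 : c < 1.
  rewrite ltr_pdivrMr ?mulrn_wgt0 // mul1r (le_lt_trans hs) //.
  by rewrite mulrS ltrDl mulrn_wgt0.
exists c; split=> // k Phi /channel_kraus[m [A [PhiA A1 AS]]].
apply: psdmx_unitvec => psi psi1.
have -> : (psi ^t* *m ((d%:R - c)%:M - Phi 1%:M) *m psi) 0 0 =
    d%:R - \sum_p (psi ^t* *m A p *m (A p) ^t* *m psi) 0 0 - c.
  rewrite mulmxBr mulmxBl mxE [Y in _ + Y]mxE mul_mx_scalar -scalemxAl psi1.
  rewrite scalemx1 [Y in Y - _]mxE eqxx mulr1n.
  rewrite addrAC; congr (_ - _ - _); rewrite PhiA mulmx_sumr mulmx_suml summxE.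
  by apply: eq_bigr => p _; rewrite mulmx1 !mulmxA.
rewrite -(tr_defect psi1 A1) subr_ge0.
set t := \tr _.
have t0 : 0 <= t.
  by apply/psdmx_tr_ge0; rewrite /defect; apply: psdmx_sum => p; apply: psdmx_gram.
have hle : `|h i j| <= s * (t *+ 3 + t ^+ 2) :=
  functional_le_defect psi1 A1 i j AS hS.
rewrite real_leNgt ?ger0_real // ?ltW //; apply/negP => tc.
have t1 : t ^+ 2 <= t by rewrite expr2 ler_piMl // ltW // (lt_trans tc).
have : `|h i j| < `|h i j|; last by rewrite ltxx.
apply: (le_lt_trans hle); apply: (@le_lt_trans _ _ (s *+ 4 * t)).
  by rewrite mulrnAl -mulrnAr ler_pM2l // [t *+ 4]mulrSr lerD.
by rewrite mulrC -ltr_pdivlMr ?mulrn_wgt0.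
Qed.

Lemma th_scalar (d : nat) (S : {vspace 'M[C]_d}) (r : C) : 0 < r ->
  (forall (k : nat) (Phi : {linear 'M[C]_d -> 'M[C]_k}),
      channels S Phi -> le_mx (Phi 1%:M) r%:M) -> th S (r^-1)%:M.
Proof.
move=> r0 Phir; split.
  move=> v; rewrite mul_mx_scalar -scalemxAl mxE mulr_ge0 ?sqnorm_ge0 //.
  by rewrite invr_ge0 ltW.
move=> k Phi /Phir H v.
have -> : Phi (r^-1)%:M = r^-1 *: Phi 1%:M by rewrite -(scalemx1 _ (r^-1)) linearZ.
have -> : 1%:M - r^-1 *: Phi 1%:M = r^-1 *: (r%:M - Phi 1%:M).
  by rewrite scalerBr -(scalemx1 _ r) scalerA mulVf ?scale1r // gt_eqF.
by rewrite -scalemxAr -scalemxAl mxE mulr_ge0 ?invr_ge0 ?(ltW r0) //; apply: H.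
Qed.

(** Channels map such a [T] to a positive matrix of trace [1], which is at most
    the identity. *)
Lemma th_density (d : nat) (S : {vspace 'M[C]_d}) (T : 'M[C]_d) :
  psdmx T -> \tr T = 1 -> th S T.
Proof.
move=> Tpsd T1; split=> // k Phi [[Phicp Phitp] PhiS].
have [m [A PhiA]] := completely_positive_kraus Phicp.
by have := psdmx_le_tr (kraus_psd PhiA Tpsd); rewrite Phitp T1.
Qed.

Lemma theta_ge1 (d : nat) (S : {vspace 'M[C]_d}) :
  (0 < d)%N -> (1%:E <= theta S)%E.
Proof.
move=> d0; pose i := Ordinal d0.
have E : \tr (delta_mx i i : 'M[C]_d) = 1.
  rewrite /mxtrace (bigD1 i) //= mxE !eqxx big1 ?addr0 // => j ji.
  by rewrite mxE (negPf ji).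
apply: ereal_sup_ubound; exists (delta_mx i i); last by rewrite E.
apply: th_density => //; rewrite -(mul_delta_mx (0 : 'I_1)).
have -> : delta_mx i (0 : 'I_1) = (delta_mx 0 i : 'M[C]__) ^t*.
  by apply/matrixP => a b; rewrite !mxE rmorph_nat andbC.
exact: psdmx_gram.
Qed.

Lemma theta_gt1 (d : nat) (S : {vspace 'M[C]_d}) :
  (0 < d)%N -> S != fullv -> (1%:E < theta S)%E.
Proof.
move=> d0 /channel_gap[c [c0 c1 Sc]].
have d1 : 1 <= d%:R :> C by rewrite ler1n.
have dc : 0 < d%:R - c by rewrite subr_gt0 (lt_le_trans c1).
pose T : 'M[C]_d := ((d%:R - c)^-1)%:M.
have : 1 < \tr T.
  by rewrite mxtrace_scalar -(mulr_natl (_ ^-1)) ltr_pdivlMr // mul1r ltrBlDr ltrDl.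
rewrite ltcE => /andP[_ Re1].
apply: (@lt_le_trans _ _ (complex.Re (\tr T))%:E); first by rewrite lte_fin.
by apply: ereal_sup_ubound; exists T => //; apply: th_scalar.
Qed.

(** * The operator norm *)

Lemma l2norm_ge0 (n : nat) (v : 'cV[C]_n) : 0 <= l2norm v.
Proof. exact: sqrtr_ge0. Qed.

Lemma sqr_l2norm (n : nat) (v : 'cV[C]_n) :
  ((l2norm v ^+ 2)%:C)%C = (v ^t* *m v) 0 0.
Proof.
rewrite sqr_sqrtr; last by rewrite sumr_ge0 // => i _; rewrite sqr_ge0.
by rewrite rmorph_sum sqnormE; apply: eq_bigr => i _; rewrite rmorphXn.
Qed.

Lemma l2normZ (n : nat) (a : R) (v : 'cV[C]_n) : 0 <= a ->
  l2norm ((a%:C)%C *: v) = a * l2norm v.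
Proof.
move=> a0; apply/eqP.
rewrite -(@eqrXn2 _ 2) ?l2norm_ge0 ?mulr_ge0 ?l2norm_ge0 //.
apply/eqP/(@complexI R); rewrite sqr_l2norm sqnormZ exprMn rmorphM /= sqr_l2norm.
by congr (_ * _); rewrite ger0_norm ?ler0c // rmorphXn.
Qed.

Lemma l2norm_eq0 (n : nat) (v : 'cV[C]_n) : l2norm v = 0 -> v = 0.
Proof. by move=> v0; apply: sqnorm_eq0; rewrite -sqr_l2norm v0 expr0n. Qed.

Lemma l2norm0 (n : nat) : l2norm (0 : 'cV[C]_n) = 0.
Proof. by rewrite -(scale0r 0) -[0 : C]/(0%:C%C) l2normZ // mul0r. Qed.

(** The operator norm is a supremum of reals, which bounds its set only if that
    set is bounded; the Hilbert-Schmidt norm of [A] is a bound. *)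
Lemma l2norm_bounded (m n : nat) (A : 'M[C]_(m, n)) :
  has_ubound [set l2norm (A *m v) | v in [set v : 'cV[C]_n | l2norm v <= 1]].
Proof.
pose b : C := \tr (A ^t* *m A).
have b0 : 0 <= b by apply/psdmx_tr_ge0/psdmx_gram.
exists (Num.sqrt (complex.Re b)) => _ [v v1 <-].
have bR : (complex.Re b)%:C%C = b by apply/RRe_real/ger0_real.
rewrite -(@ler_sqr R) ?nnegrE ?l2norm_ge0 ?sqrtr_ge0 //.
have Reb0 : 0 <= complex.Re b by rewrite -ler0c bR.
rewrite (sqr_sqrtr Reb0).
rewrite -lecR sqr_l2norm bR.
have := psdmx_le_tr (psdmx_gram A) v.
rewrite mulmxBr mulmxBl mxE [X in _ + X]mxE subr_ge0 mulmxA -adjmxM -mulmxA.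
move=> /le_trans; apply; rewrite mul_mx_scalar -scalemxAl mxE.
rewrite ler_piMr // -sqr_l2norm -[1]/(1%:C%C) lecR.
by rewrite expr_le1 // l2norm_ge0.
Qed.

Lemma l2norm_opnorm (m n : nat) (A : 'M[C]_(m, n)) (v : 'cV[C]_n) :
  l2norm (A *m v) <= opnorm A * l2norm v.
Proof.
have [v0|v0] := eqVneq (l2norm v) 0.
  by rewrite v0 mulr0 (l2norm_eq0 v0) mulmx0 l2norm0.
have vp : 0 < l2norm v by rewrite lt_def v0 l2norm_ge0.
rewrite -ler_pdivrMr // mulrC -l2normZ ?invr_ge0 ?l2norm_ge0 // scalemxAr.
apply: ub_le_sup; first exact: l2norm_bounded.
by exists (((l2norm v)^-1%:C)%C *: v) => //=;
  rewrite l2normZ ?mulVf // invr_ge0 l2norm_ge0.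
Qed.
Lemma opnorm_ge0 (m n : nat) (A : 'M[C]_(m, n)) : 0 <= opnorm A.
Proof.
apply: ub_le_sup; first exact: l2norm_bounded.
by exists 0; rewrite /= ?l2norm0 ?ler01 // mulmx0 l2norm0.
Qed.

Lemma opnorm1_le1 (n : nat) : opnorm (1%:M : 'M[C]_n) <= 1.
Proof.
apply: ge_sup => [|_ [v v1 <-]]; last by rewrite mul1mx.
by exists (l2norm (1%:M *m 0 : 'cV[C]_n)), 0; rewrite //= l2norm0 ler01.
Qed.

End Theta.

(** * Weak duality and the full matrix space *)

Section Duality.
Variable R : realType.
Local Notation C := R[i].

(** Let [r := opnorm (K^-1)], [w := K^-1 v], [a := v^* v], [b := v^* K v] and
    [c := w^* v = w^* K w]. Cauchy-Schwarz for the form of [K] gives [a^2 <= c b], since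
    [w^* K v = a]; the ordinary one gives [c <= r a]. Together,
    [a <= r b]. *)
Lemma le1_opnorm_invmx (n : nat) (K : 'M[C]_n) :
  psdmx K -> K \in unitmx -> le_mx 1%:M ((opnorm (invmx K))%:C%C *: K).
Proof.
move=> Kpsd Kunit v; set r := opnorm (invmx K).
pose w := invmx K *m v.
have Kw : K *m w = v by rewrite mulKVmx.
have wv : l2norm w <= r * l2norm v by exact: l2norm_opnorm.
(* From here on [w] is any solution of [K w = v] with this norm bound. *)
move: w Kw wv => w Kw wv.
have r0 : 0 <= r%:C%C by rewrite ler0c opnorm_ge0.
set a := (v ^t* *m v) 0 0; pose b := (v ^t* *m K *m v) 0 0.
pose c := (w ^t* *m v) 0 0.
have a0 : 0 <= a by exact: sqnorm_ge0.
have b0 : 0 <= b by exact: Kpsd.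
have c0 : 0 <= c by rewrite /c -Kw mulmxA; exact: Kpsd.
have [G KG] := psdmx_gram_ex Kpsd.
have ab : a ^+ 2 <= c * b.
  have := CauchySchwarz_cV (G *m w) (G *m v).
  rewrite !adjmxM !mulmxA -![_ *m G ^t* *m G]mulmxA -KG.
  have -> : w ^t* *m K = v ^t* by rewrite -Kw adjmxM (psdmx_herm Kpsd).
  have -> : v ^t* *m w = (w ^t* *m v) ^t* by rewrite adjmxM trmxCK.
  rewrite -/a -/b (ger0_norm a0) => /le_trans; apply.
  by rewrite ler_wpM2r // mxE mxE -/c (geC0_conj c0).
have ca : c <= r%:C%C * a.
  rewrite -(@ler_sqr C) ?nnegrE ?mulr_ge0 // -[X in X ^+ 2 <= _](ger0_norm c0).
  apply: (le_trans (CauchySchwarz_cV _ _)).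
  rewrite exprMn [a ^+ 2]expr2 mulrA -/a ler_wpM2r // /a -!sqr_l2norm.
  rewrite -rmorphXn -rmorphM lecR -exprMn ler_sqr // nnegrE ?l2norm_ge0 //.
  by rewrite mulr_ge0 ?l2norm_ge0 ?opnorm_ge0.
have E : (v ^t* *m (r%:C%C *: K - 1%:M) *m v) 0 0 = r%:C%C * b - a.
  rewrite mulmxBr mulmxBl mulmx1 -scalemxAr -scalemxAl.
  by rewrite mxE [X in X + _]mxE [X in _ + X]mxE.
rewrite E subr_ge0; have [->|an0] := eqVneq a 0; first exact: mulr_ge0.
have ap : 0 < a by rewrite lt_def an0.
rewrite -(ler_pM2l ap) -expr2 (le_trans ab) // mulrCA mulrA.
by rewrite ler_wpM2r.
Qed.

(** [v^* Phi^*(Y) v] is [Tr (Phi(v v^* ) Y)]. *)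
Lemma psdmx_dual_map (d k m : nat) (Phi : {linear 'M[C]_d -> 'M[C]_k})
    (A : 'I_m -> 'M[C]_(k, d)) (Y : 'M[C]_k) :
  kraus_rep Phi A -> psdmx Y -> psdmx (dual_map Phi Y).
Proof.
move=> PhiA Ypsd v; rewrite -trace_mx11 mxtrace_mulC mulmxA dual_mapP.
apply: psdmx_trM_ge0 => //; apply: (kraus_psd PhiA).
by rewrite -{1}[v]trmxCK; apply: psdmx_gram.
Qed.

Lemma theta_le_theta_hat (d : nat) (S : {vspace 'M[C]_d}) :
  (theta S <= theta_hat S)%E.
Proof.
apply: ge_ereal_sup => _ [T [Tpsd TS] <-]; apply: le_ereal_inf_tmp.
move=> _ [k [Phi [sigma [PhiS sigma_psd sigma1 Kunit ->]]]]; rewrite lee_fin.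
have [m [A [PhiA _ _]]] := channel_kraus PhiS.
set K := dual_map Phi sigma in Kunit *.
have Kpsd : psdmx K by apply: (psdmx_dual_map PhiA).
have r0 := opnorm_ge0 (invmx K); set r := opnorm (invmx K) in r0 *.
have TK : \tr (T *m K) <= 1.
  rewrite dual_mapP; apply: le_trans sigma1.
  have := psdmx_trM_ge0 (TS _ _ PhiS) sigma_psd.
  by rewrite mulmxBl mul1mx raddfB subr_ge0.
have : \tr T <= r%:C%C.
  apply: (@le_trans _ _ (r%:C%C * \tr (T *m K))); last first.
    by rewrite ler_piMr // ler0c.
  have := psdmx_trM_ge0 Tpsd (le1_opnorm_invmx Kpsd Kunit).
  by rewrite mulmxBr mulmx1 raddfB /= -scalemxAr mxtraceZ subr_ge0.
by rewrite lecE => /andP[].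
Qed.

Definition trace_map (d : nat) (T : 'M[C]_d) : 'M[C]_1 := (\tr T)%:M.

Lemma trace_map_is_linear (d : nat) : linear (@trace_map d).
Proof.
by move=> a T U; rewrite /trace_map linearP raddfD /= scale_scalar_mx.
Qed.

HB.instance Definition _ (d : nat) :=
  GRing.isLinear.Build C 'M[C]_d 'M[C]_1 _ (@trace_map d)
    (@trace_map_is_linear d).

(** The trace is [\sum_p e_p^* T e_p]. *)
Lemma trace_map_kraus (d : nat) :
  kraus_rep (@trace_map d) (fun p : 'I_d => delta_mx 0 p).
Proof.
move=> T; apply/matrixP => i j; rewrite !ord1 mxE mulr1n summxE.
apply: eq_bigr => p _; rewrite -rowE.
have -> : (delta_mx 0 p : 'M[C]_(1, d)) ^t* = delta_mx p 0.
  by apply/matrixP => a b; rewrite !mxE rmorph_nat andbC.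
by rewrite -colE !mxE.
Qed.

Lemma trace_map_channel (d : nat) :
  channels (fullv : {vspace 'M[C]_d}) (@trace_map d).
Proof.
split; last by move=> X _; exact: memvf.
split; first exact: kraus_completely_positive (@trace_map_kraus d).
by move=> T; rewrite mxtrace_scalar.
Qed.

Lemma dual_trace_map1 (d : nat) : dual_map (@trace_map d) 1%:M = 1%:M.
Proof.
apply/esym/dual_map_unique => T.
by rewrite !mulmx1 mxtrace_scalar.
Qed.

Lemma theta_hat_full_le1 (d : nat) :
  (theta_hat (fullv : {vspace 'M[C]_d}) <= 1%:E)%E.
Proof.
apply: ge_ereal_inf; exists (opnorm (1%:M : 'M[C]_d))%:E; last first.
  by rewrite lee_fin opnorm1_le1.
exists 1%N, (@trace_map d), 1%:M; rewrite dual_trace_map1 invmx1; split=> //.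
- exact: trace_map_channel.
- by move=> v; rewrite mulmx1 sqnorm_ge0.
- by rewrite mxtrace1.
- exact: unitmx1.
Qed.

End Duality.

Theorem proposition6p7 (R : realType) (d : nat) (d_gt0 : (0 < d)%N)
    (S : {vspace 'M[R[i]]_d}) (S_opsys : operator_system S) :
  [<-> theta S = 1%:E; theta_hat S = 1%:E; S = {:'M[R[i]]_d}%VS].
Proof.
have le_th := theta_le_theta_hat S.
have ge1 := theta_ge1 S d_gt0.
have full_le1 : S = fullv -> (theta_hat S <= 1%:E)%E.
  by move=> ->; exact: theta_hat_full_le1.
have full : (theta S <= 1%:E)%E -> S = fullv.
  move=> th1; apply/eqP; apply: contraTT th1 => Sn.
  by rewrite -ltNge; apply: theta_gt1.
tfae.
- move=> th1; apply/le_anti; rewrite full_le1 -?th1 ?le_th //.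
  by apply: full; rewrite th1.
- by move=> th1; apply: full; rewrite -th1.
- by move=> /full_le1 ?; apply/le_anti; rewrite ge1 (le_trans le_th).
Qed.
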